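(* Let $\alpha\in(0,1]$ and let $E\subseteq\mathbb{R}^2$ be an $F^+_\alpha$-set. Let $h\in\mathbb{H}$ be any dimension function for which there are constants $C>0$ and $\theta>2$ such that $$h(x)\ge C\, x^{2\alpha}\log^{1+\theta}\!\left(\tfrac1x\right)$$ for all sufficiently small $x>0$. Then $\mathcal{H}^{h}(E)>0$.
   Context: Dimension functions: $\mathbb{H}$ is the set of functions $h:[0,\infty)\to[0,\infty)$ that are non-decreasing, right continuous, and satisfy $h(0)=0$. Hausdorff measures: for $h\in\mathbb{H}$, $E\subseteq\mathbb{R}^2$ and $\delta>0$, $\mathcal{H}^h_\delta(E)=\inf\{\sum_i h(\operatorname{diam}(E_i)) : E\subseteq\bigcup_{i=1}^\infty E_i,\ \operatorname{diam}(E_i)<\delta\}$, and $\mathcal{H}^h(E)=\sup_{\delta>0}\mathcal{H}^h_\delta(E)$. $\mathcal{H}^\alpha$ denotes $\mathcal{H}^{h}$ with $h(x)=x^\alpha$. A set $E\subseteq\mathbb{R}^2$ is an $F^+_\alpha$-set if for each direction $e$ in the unit circle $\mathbb{S}$ there is a line segment $\ell_e$ in the direction of $e$ such that $\mathcal{H}^{\alpha}(\ell_e\cap E)>0$. Notation: $\log^{p}(y)=(\log y)^p$. *)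

(* Defs.v *)
From mathcomp Require Export all_boot all_order all_algebra.
From mathcomp Require Export all_classical all_reals all_analysis.

Set Implicit Arguments.
Unset Strict Implicit.
Unset Printing Implicit Defensive.

Export Order.TTheory GRing.Theory Num.Theory.
Export numFieldNormedType.Exports.

Local Open Scope classical_set_scope.
Local Open Scope ring_scope.

(* The plane is [R * R]. The norm the library puts on a product is the sup
   norm, so the Euclidean distance is written out. *)
Definition edist (R : realType) (p q : R * R) : R :=
  Num.sqrt ((p.1 - q.1) ^+ 2 + (p.2 - q.2) ^+ 2).

(* The extra element 0 gives [diam set0 = 0] (the supremum of the empty set is
   -oo in [\bar R]) and changes nothing when [A] is nonempty. *)
Definition diam (R : realType) (A : set (R * R)) : \bar R :=
  ereal_sup (0%E |` [set (edist p q)%:E | p in A & q in A]).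

(* A function [0, oo) -> [0, oo) is represented by a function [R -> R], whose
   values at negative arguments are irrelevant. *)
Definition dimension_function (R : realType) (h : R -> R) : Prop :=
  [/\ forall x : R, 0 <= x -> 0 <= h x,
      forall x y : R, 0 <= x -> x <= y -> h x <= h y,
      forall x : R, 0 <= x -> h y @[y --> x^'+] --> h x
    & h 0 = 0].

(* [fine] is harmless here: every [diam (F i)] is bounded by [delta]. *)
Definition hausdorff_content (R : realType) (h : R -> R) (delta : R)
    (E : set (R * R)) : \bar R :=
  ereal_inf [set (\sum_(0 <= i <oo) (h (fine (diam (F i))))%:E)%E
            | F in [set F : nat -> set (R * R) |
                E `<=` \bigcup_i F i /\
                (forall i, (diam (F i) < delta%:E)%E)]].

Definition hausdorff_measure (R : realType) (h : R -> R) (E : set (R * R)) :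
    \bar R :=
  ereal_sup [set hausdorff_content h delta E | delta in [set d : R | 0 < d]].

Definition unit_circle (R : realType) : set (R * R) :=
  [set e | edist e 0 = 1].

Definition segment (R : realType) (p e : R * R) (L : R) : set (R * R) :=
  [set p + t *: e | t in `[0, L]].

Definition Fplus_set (R : realType) (alpha : R) (E : set (R * R)) : Prop :=
  forall e : R * R, unit_circle e ->
    exists (p : R * R) (L : R), 0 < L /\
      (0 < hausdorff_measure (fun x : R => x `^ alpha)%R
             (segment p e L `&` E))%E.

(* Main.v *)
Require Import Defs.
From mathcomp Require Import ring lra zify.

(** Suppose that the measure of [E] for [h] is 0. Only directions (1, t) with
    slope t in [0, 1) are needed. On the line of slope t chosen by the
    hypothesis lies a piece of [E] with positive [alpha]-content, and the slopes
    fall into countably many classes [rich_slope alpha E m] according to how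
    large this content and how long the piece is. Each class is Lebesgue null
    ([null_rich_slopes]), so [0, 1) would be null.

    To see that a class is null, cover [E] by sets [F i] with a small sum of
    [h (diam (F i))] and sort them by the dyadic scale k of their diameters. One
    set is retained for each square of side [2 ^- k], so that only boundedly
    many retained sets sit at any place ([leader], [content_le_hits]). If t is
    rich, then by a pigeonhole over the scales ([exists_rich_scale]) its piece
    hits, for some k, at least lambda_k ~ 2^(k alpha) k^(- theta / 2) retained
    sets of that scale; this is possible because the sum of
    k^(- theta / 2) converges when [2 < theta].

    The measure of the slopes with this property for a given k is estimated by
    the Kakeya (Cordoba) argument in the plane: lines of slopes t and t' share
    at most a multiple of 1 / |t - t'| squares, so Cauchy-Schwarz and a harmonic
    sum ([incidence_bound], [card_rich_slopes_le]) bound this measure by a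
    multiple of k N_k / lambda_k^2, where N_k is the number of retained sets.
    This is of the order of N_k 2^(- 2 k alpha) k^(1 + theta), hence at most a
    multiple of the sum of [h] over the retained sets of scale k, and summing
    over k gives at most a multiple of the small sum of [h] ([slope_const_bound],
    [sum_scales_le]). *)

Set Implicit Arguments.
Unset Strict Implicit.
Unset Printing Implicit Defensive.

Local Open Scope classical_set_scope.
Local Open Scope ring_scope.

(** * Incidence counting *)

(** Cauchy-Schwarz against the constant function 1: the variance of [f] on [A]
    is nonnegative. *)
Lemma sqr_sum_le_card (R : realFieldType) (I : finType) (A : {set I})
    (f : I -> R) :
  (\sum_(i in A) f i) ^+ 2 <= #|A|%:R * \sum_(i in A) f i ^+ 2.
Proof.
set S := \sum_(i in A) f i; set Q := \sum_(i in A) f i ^+ 2.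
set n : R := #|A|%:R.
have [A0|A0] := posnP #|A|.
  have E0 : A = finset.set0 by apply/eqP; rewrite -cards_eq0 A0.
  by rewrite /S /Q E0 !big_set0 expr0n mulr0.
have n0 : 0 < n by rewrite ltr0n.
have : 0 <= \sum_(i in A) (n * f i - S) ^+ 2 by apply: sumr_ge0 => i _; exact: sqr_ge0.
have -> : \sum_(i in A) (n * f i - S) ^+ 2 = n * (n * Q - S ^+ 2).
  transitivity (\sum_(i in A) (n ^+ 2 * f i ^+ 2 - 2 * n * S * f i + S ^+ 2)).
    by apply: eq_bigr => i _; ring.
  rewrite big_split/= sumrB -!mulr_sumr sumr_const -/S -/Q -mulr_natl -/n.
  ring.
by rewrite pmulr_rge0// subr_ge0.
Qed.

Lemma harmonic_pow2_le (R : realFieldType) (k : nat) :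
  \sum_(0 <= d < 2 ^ k) (d.+1%:R : R)^-1 <= k.+1%:R.
Proof.
elim: k => [|k IH]; first by rewrite expn0 big_nat1 invr1.
rewrite (@big_cat_nat _ _ _ (2 ^ k)) ?leq_pexp2l//= -[k.+2]addn1 natrD lerD//.
apply: (@le_trans _ _ (\sum_(2 ^ k <= d < 2 ^ k.+1) ((2 ^ k)%:R)^-1)).
  rewrite big_nat_cond [leRHS]big_nat_cond.
  apply: ler_sum => d /andP[/andP[kd _] _].
  by rewrite lef_pV2 ?posrE ?ltr0n ?expn_gt0// ler_nat (leq_trans kd).
rewrite sumr_const_nat expnS mul2n -addnn addnK -[leLHS]mulr_natl.
by rewrite divff// pnatr_eq0 -lt0n expn_gt0.
Qed.

Lemma sum_inv_dist_le (R : realFieldType) (k n : nat) : (n < 2 ^ k)%N ->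
  \sum_(n' < 2 ^ k) (((n - n') + (n' - n)).+1%:R : R)^-1 <= 2 * k.+1%:R.
Proof.
move=> nk.
have mono a b : (b <= 2 ^ k)%N ->
    \sum_(0 <= d < b) ((a + d).+1%:R : R)^-1 <= k.+1%:R.
  move=> bk; apply: le_trans (harmonic_pow2_le R k).
  rewrite (big_cat_nat (leq0n b) bk)/=.
  apply: ler_wpDr; first by apply: sumr_ge0 => i _; rewrite invr_ge0.
  apply: ler_sum => d _.
  by rewrite lef_pV2 ?posrE ?ltr0n// ler_nat ltnS leq_addl.
rewrite -(big_mkord xpredT (fun n' => (((n - n') + (n' - n)).+1%:R : R)^-1)).
rewrite (big_cat_nat (leq0n n) (ltnW nk))/= mulr2n mulrDl mul1r lerD//.
  rewrite big_nat_rev/=.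
  rewrite (eq_big_nat _ _ (F2 := fun d => ((1 + d).+1%:R : R)^-1)); last first.
    move=> d /andP[_ dn]; congr ((_.+1)%:R^-1); lia.
  by apply: mono; exact: ltnW.
rewrite -[X in \sum_(X <= _ < _) _]add0n big_addn.
rewrite (eq_big_nat _ _ (F2 := fun d => ((0 + d).+1%:R : R)^-1)); last first.
  move=> d /andP[_ dn]; congr ((_.+1)%:R^-1); lia.
by apply: mono; exact: leq_subr.
Qed.

(** Cordoba's argument. Counting the pairs (direction, cell) with
    multiplicities [m i], Cauchy-Schwarz over the cells gives
    (|T| lam)^2 <= |J| * sum of [m i ^+ 2], and the last sum counts the cells
    common to two directions. Since these are at most [D / (distance + 1)], each
    direction contributes a harmonic sum, which is the factor [k.+1]: the only
    loss is logarithmic in the number of directions. *)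
Lemma incidence_bound (R : realFieldType) (k : nat) (I : finType)
    (T : {set 'I_(2 ^ k)}) (J : {set I}) (inc : 'I_(2 ^ k) -> {set I})
    (D lam : R) : 0 <= D -> 0 <= lam ->
  (forall t, t \in T -> inc t \subset J) ->
  (forall t t', t \in T -> t' \in T ->
     #|inc t :&: inc t'|%:R <= D / (((t - t') + (t' - t)).+1%:R)) ->
  (forall t, t \in T -> lam <= #|inc t|%:R) ->
  #|T|%:R * lam ^+ 2 <= #|J|%:R * D * (2 * k.+1%:R).
Proof.
move=> D0 lam0 incJ pair many.
have [T0|T0] := posnP #|T|.
  by rewrite T0 mul0r !mulr_ge0.
pose m i : R := \sum_(t in T) (i \in inc t)%:R.
have cardE (A : {set I}) : A \subset J -> (#|A|%:R : R) = \sum_(i in J) (i \in A)%:R.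
  move=> AJ; rewrite -sum1_card natr_sum big_mkcond [RHS]big_mkcond/=.
  apply: eq_bigr => i _; case: (boolP (i \in A)) => [iA|_].
    by rewrite (fintype.subsetP AJ).
  by rewrite if_same.
have S1 : #|T|%:R * lam <= \sum_(i in J) m i.
  rewrite exchange_big/= mulr_natl -sumr_const ler_sum// => t tT.
  by rewrite -cardE ?many ?incJ.
have S2 : \sum_(i in J) m i ^+ 2 <= #|T|%:R * (D * (2 * k.+1%:R)).
  have -> : \sum_(i in J) m i ^+ 2 =
      \sum_(t in T) \sum_(t' in T) (#|inc t :&: inc t'|%:R : R).
    under eq_bigr => i _.
      rewrite expr2 /m mulr_suml; under eq_bigr do rewrite mulr_sumr.
      over.
    rewrite exchange_big; apply: eq_bigr => t tT.
    rewrite exchange_big; apply: eq_bigr => t' t'T.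
    rewrite cardE//; last by rewrite (fintype.subset_trans (finset.subsetIl _ _)) ?incJ.
    by apply: eq_bigr => i _; rewrite inE -natrM mulnb.
  rewrite mulr_natl -sumr_const ler_sum// => t tT.
  apply: (@le_trans _ _ (\sum_(t' in T) D / (((t - t') + (t' - t)).+1%:R))).
    by apply: ler_sum => t' t'T; exact: pair.
  rewrite -mulr_sumr ler_wpM2l//.
  apply: le_trans (@sum_inv_dist_le R k t (ltn_ord t)).
  rewrite big_mkcond; apply: ler_sum => t' _.
  by case: ifP => // _; rewrite invr_ge0.
have n0 : 0 < (#|T|%:R : R) by rewrite ltr0n.
rewrite -(ler_pM2l n0).
apply: (@le_trans _ _ ((\sum_(i in J) m i) ^+ 2)).
  rewrite [leLHS](_ : _ = (#|T|%:R * lam) ^+ 2); last by ring.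
  by rewrite ler_sqr ?nnegrE ?mulr_ge0// (le_trans _ S1) ?mulr_ge0.
apply: (le_trans (sqr_sum_le_card _ _)).
rewrite [leRHS](_ : _ = #|J|%:R * (#|T|%:R * (D * (2 * k.+1%:R)))); last by ring.
by rewrite ler_wpM2l.
Qed.

(** The strip has one window of bounded height above each abscissa, and the
    windows may move with the abscissa: this is how lattice points close to a
    line are counted. *)
Lemma card_lattice_strip_le (R : realType) (I : finType) (A : {set I})
    (a b : I -> int) (v : int -> R) (u w : R) (c : nat) : 0 <= w ->
  {in A &, injective (fun i => (a i, b i))} ->
  (forall i, i \in A -> u <= (a i)%:~R <= u + w) ->
  (forall i, i \in A -> v (a i) <= (b i)%:~R <= v (a i) + c%:R) ->
  #|A|%:R <= (w + 1) * c.+1%:R.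
Proof.
move=> w0 inj ha hb.
have off (x y : R) (z : int) : x <= z%:~R <= x + y -> 0 <= y ->
    (`|z - Num.ceil x| <= Num.truncn y)%N /\ 0 <= z - Num.ceil x.
  move=> /andP[xz zx] y0.
  have cz : Num.ceil x <= z by rewrite ceil_le_int.
  have zc0 : 0 <= z - Num.ceil x by rewrite subr_ge0.
  split => //.
  rewrite truncn_ge_nat//.
  rewrite -[X in X <= _]/((`|z - Num.ceil x|%N : int)%:~R).
  rewrite gez0_abs// intrD mulrNz.
  have := ceil_ge x; lra.
(* Offsets from the lower ends of the two windows. *)
pose f i : 'I_(Num.truncn w).+1 * 'I_c.+1 :=
  (inord `|a i - Num.ceil u|%N, inord `|b i - Num.ceil (v (a i))|%N).
have fE i : i \in A -> [/\ ((f i).1 : nat) = `|a i - Num.ceil u|%N,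
    ((f i).2 : nat) = `|b i - Num.ceil (v (a i))|%N,
    0 <= a i - Num.ceil u & 0 <= b i - Num.ceil (v (a i))].
  move=> iA; have [a1 a2] := off _ _ _ (ha _ iA) w0.
  have [b1 b2] := off _ _ _ (hb _ iA) (ler0n _ _).
  by rewrite natrK in b1; split=> //=; rewrite inordK.
have finj : {in A &, injective f}.
  move=> i j iA jA fij; apply: inj => //.
  have [i1 i2 i3 i4] := fE _ iA; have [j1 j2 j3 j4] := fE _ jA.
  have aij : a i = a j.
    have : `|a i - Num.ceil u|%N = `|a j - Num.ceil u|%N by rewrite -i1 -j1 fij.
    by lia.
  congr (_, _) => //.
  have : `|b i - Num.ceil (v (a i))|%N = `|b j - Num.ceil (v (a j))|%N by rewrite -i2 -j2 fij.
  by rewrite aij in i4 *; lia.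
have : (#|A| <= (Num.truncn w).+1 * c.+1)%N.
  rewrite -(card_in_imset finj) -[X in (_ <= X)%N](_ : #|{: 'I_(Num.truncn w).+1 * 'I_c.+1}| = _).
    exact: max_card.
  by rewrite card_prod !card_ord.
rewrite -(ler_nat R) => /le_trans; apply.
rewrite natrM ler_wpM2r// -natr1 lerD2r.
by rewrite truncn_le.
Qed.

(** * Diameters in the Euclidean metric *)

Lemma ler_norm_edist1 (R : realType) (p q : R * R) : `|p.1 - q.1| <= edist p q.
Proof. by rewrite -sqrtr_sqr ler_wsqrtr// lerDl sqr_ge0. Qed.

Lemma ler_norm_edist2 (R : realType) (p q : R * R) : `|p.2 - q.2| <= edist p q.
Proof. by rewrite -sqrtr_sqr ler_wsqrtr// lerDr sqr_ge0. Qed.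

Lemma edist_le_sum (R : realType) (p q : R * R) :
  edist p q <= `|p.1 - q.1| + `|p.2 - q.2|.
Proof.
have e0 : 0 <= `|p.1 - q.1| + `|p.2 - q.2| by rewrite addr_ge0.
rewrite -[leRHS](ger0_norm e0) -(sqrtr_sqr (_ + _)) ler_wsqrtr//.
rewrite [leRHS]sqrrD !real_normK ?num_real// -addrA lerD2l lerDr.
by rewrite mulrn_wge0// mulr_ge0.
Qed.

Lemma edist_le_center (R : realType) (p q c : R * R) (r : R) :
  `|p.1 - c.1| <= r -> `|p.2 - c.2| <= r ->
  `|q.1 - c.1| <= r -> `|q.2 - c.2| <= r -> edist p q <= 4 * r.
Proof.
move=> p1 p2 q1 q2; apply: (le_trans (edist_le_sum _ _)).
have := ler_distD c.1 p.1 q.1; have := ler_distD c.2 p.2 q.2.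
rewrite (distrC c.1 q.1) (distrC c.2 q.2); lra.
Qed.

Lemma diam_ge0 (R : realType) (A : set (R * R)) : (0 <= diam A)%E.
Proof. by apply: ereal_sup_ubound; left. Qed.

Lemma diam_le (R : realType) (A : set (R * R)) (r : R) : 0 <= r ->
  (forall p q, A p -> A q -> edist p q <= r) -> (diam A <= r%:E)%E.
Proof.
move=> r0 Ar; apply: ge_ereal_sup => _ [->|[p Ap [q Aq <-]]].
  by rewrite lee_fin.
by rewrite lee_fin Ar.
Qed.

Lemma diam_set0 (R : realType) : diam (@set0 (R * R)) = 0%E.
Proof. by apply/eqP; rewrite eq_le diam_ge0 diam_le. Qed.

Lemma sub_diam (R : realType) (A B : set (R * R)) :
  A `<=` B -> (diam A <= diam B)%E.
Proof.
move=> AB; apply: ge_ereal_sup => _ [->|[p Ap [q Aq <-]]].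
  exact: diam_ge0.
by apply: ereal_sup_ubound; right; exists p; [exact: AB|exists q => //; exact: AB].
Qed.

Definition rdiam (R : realType) (A : set (R * R)) : R := fine (diam A).

Lemma rdiam_ge0 (R : realType) (A : set (R * R)) : 0 <= rdiam A.
Proof. by rewrite fine_ge0// diam_ge0. Qed.

Lemma rdiamK (R : realType) (A : set (R * R)) (delta : R) :
  (diam A < delta%:E)%E -> (rdiam A)%:E = diam A.
Proof.
by move=> Ad; rewrite fineK// ge0_fin_numE ?diam_ge0// (lt_le_trans Ad)// leey.
Qed.

Lemma edist_le_rdiam (R : realType) (A : set (R * R)) (delta : R) p q :
  (diam A < delta%:E)%E -> A p -> A q -> edist p q <= rdiam A.
Proof.
move=> Ad Ap Aq; rewrite -lee_fin (rdiamK Ad).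
by apply: ereal_sup_ubound; right; exists p => //; exists q.
Qed.

(** * Sorting a cover by dyadic cells *)

Definition scale (R : realType) (d : R) : nat :=
  xget 0%N [set k : nat | 2 ^- k.+1 <= d < 2 ^- k].

Lemma scaleP (R : realType) (d : R) : 0 < d < 1 ->
  2 ^- (scale d).+1 <= d < 2 ^- (scale d).
Proof.
move=> /andP[d0 d1].
have ex : exists k : nat, 2 ^- k.+1 <= d.
  exists (Num.truncn d^-1); rewrite invf_ple ?posrE ?exprn_gt0//.
  apply: (le_trans (ltW (truncnS_gt _))).
  by rewrite -natrX ler_nat ltnW// ltn_expl.
apply: (@xgetPex _ 0%N [set k : nat | 2 ^- k.+1 <= d < 2 ^- k]).
exists (ex_minn ex); case: ex_minnP => -[|k] kd kmin /=.
  by rewrite kd/= expr0 invr1.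
rewrite kd/= ltNge; apply/negP => /kmin; by rewrite ltnn.
Qed.

Definition scale_of (R : realType) (F : nat -> set (R * R)) i : nat :=
  scale (rdiam (F i)).

(** The point, arbitrary in [F i], that attaches this set to a square of the
    grid. *)
Definition site (R : realType) (F : nat -> set (R * R)) i : R * R := xget 0 (F i).

Definition cell (R : realType) (F : nat -> set (R * R)) i : nat * int * int :=
  (scale_of F i, Num.floor (2 ^+ scale_of F i * (site F i).1),
   Num.floor (2 ^+ scale_of F i * (site F i).2)).

(** Sets of a cover may repeat or overlap without control, which would ruin any
    count of the sets meeting two given lines. So one index is kept in each
    nonempty cell, the smallest one, and it stands for the whole cell. *)
Definition leader (R : realType) (F : nat -> set (R * R)) i : bool :=
  (0 < rdiam (F i)) &&
  [forall j : 'I_i, (0 < rdiam (F j)) ==> (cell F j != cell F i)].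

(** Large enough to contain every [F j] of positive diameter in the cell of [i];
    see [cell_vicinity]. *)
Definition vicinity (R : realType) (F : nat -> set (R * R)) i : set (R * R) :=
  [set p : R * R | `|p.1 - (site F i).1| <= 2 * 2 ^- scale_of F i /\
           `|p.2 - (site F i).2| <= 2 * 2 ^- scale_of F i].

Definition hits (R : realType) (F : nat -> set (R * R)) (A : set (R * R)) i :
    bool :=
  leader F i && `[< A `&` vicinity F i !=set0 >].

Lemma leader_ex (R : realType) (F : nat -> set (R * R)) i : 0 < rdiam (F i) ->
  exists2 j, leader F j & cell F j = cell F i.
Proof.
move=> di.
have ex : exists j, (0 < rdiam (F j)) && (cell F j == cell F i).
  by exists i; rewrite di eqxx.
case: (ex_minnP ex) => j /andP[dj /eqP cj] jmin; exists j => //.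
rewrite /leader dj/=; apply/forallP => l; apply/implyP => dl.
apply/eqP => clj; have := jmin l.
by rewrite dl clj cj eqxx => /(_ isT); rewrite leqNgt ltn_ord.
Qed.

Lemma leader_inj (R : realType) (F : nat -> set (R * R)) i j :
  leader F i -> leader F j -> cell F i = cell F j -> i = j.
Proof.
move=> /andP[di /forallP hi] /andP[dj /forallP hj] cij.
case: (ltngtP i j) => // [ij|ji].
  by have := hj (Ordinal ij); rewrite /= di cij eqxx.
by have := hi (Ordinal ji); rewrite /= dj cij eqxx.
Qed.

Lemma floor_near (R : realType) (x : R) : `|x - (Num.floor x)%:~R| <= 1.
Proof. by have /andP[] := floor_itv x; rewrite intrD ler_norml => ? ?; lra. Qed.

Lemma floor_eq_near (R : realType) (x y : R) :
  Num.floor x = Num.floor y -> `|x - y| <= 1.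
Proof.
move=> xy; have := floor_itv x; have := floor_itv y; rewrite xy intrD ler_norml.
by move=> /andP[? ?] /andP[? ?]; lra.
Qed.

Lemma dist_le_double (R : realType) (x y z r : R) :
  `|x - y| <= r -> `|z - y| <= r -> `|x - z| <= 2 * r.
Proof.
move=> xy zy; apply: (le_trans (ler_distD y _ _)).
by rewrite (distrC y) mulr2n mulrDl mul1r lerD.
Qed.

Lemma cell_vicinity (R : realType) (F : nat -> set (R * R)) (delta : R) i j :
  delta <= 1 ->
  (forall i, (diam (F i) < delta%:E)%E) ->
  0 < rdiam (F i) -> cell F j = cell F i -> F i `<=` vicinity F j.
Proof.
move=> d1 Fd di [sji c1 c2] p Fp; rewrite /vicinity/= sji.
have Fs : F i (site F i) by apply: (@xgetPex _ _ (F i)); exists p.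
have r1 : rdiam (F i) <= 2 ^- scale_of F i.
  have di1 : 0 < rdiam (F i) < 1.
    by rewrite di -lte_fin (rdiamK (Fd i)) (lt_le_trans (Fd i)).
  by have /andP[_ /ltW] := scaleP di1.
have e := edist_le_rdiam (Fd i) Fp Fs.
have e1 := le_trans (le_trans (ler_norm_edist1 p (site F i)) e) r1.
have e2 := le_trans (le_trans (ler_norm_edist2 p (site F i)) e) r1.
have s0 : 0 < (2 : R) ^+ scale_of F i by exact: exprn_gt0.
have sc (x y : R) : `|2 ^+ scale_of F i * x - 2 ^+ scale_of F i * y| <= 1 ->
    `|x - y| <= 2 ^- scale_of F i.
  by rewrite -mulrBr normrM gtr0_norm// -ler_pdivlMl// mulr1.
rewrite sji in c1 c2.
have f1 := sc _ _ (floor_eq_near c1); have f2 := sc _ _ (floor_eq_near c2).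
by split; [exact: dist_le_double e1 f1|exact: dist_le_double e2 f2].
Qed.

(** A cover of [A] is turned into one indexed by leaders: each [F i] of positive
    diameter is absorbed by the vicinity of the leader of its cell, whose
    diameter is at most 16 times that of the leader's set. Sets of diameter 0
    are kept; as [0 `^ alpha = 0], they cost nothing. *)
Lemma content_le_hits (R : realType) (F : nat -> set (R * R))
    (A : set (R * R)) (alpha delta : R) : 0 < alpha -> delta <= 1 ->
  (forall i, (diam (F i) < delta%:E)%E) -> A `<=` \bigcup_i F i ->
  (hausdorff_content (fun x : R => x `^ alpha)%R (16 * delta) A <=
   \sum_(0 <= i <oo)
     (if hits F A i then (8 * 2 ^- scale_of F i) `^ alpha else 0)%:E)%E.
Proof.
move=> a0 d1 Fd AF.
have delta0 : 0 < delta by rewrite -lte_fin (le_lt_trans (diam_ge0 (F 0%N)) (Fd 0%N)).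
pose G i := A `&` (if rdiam (F i) == 0 then F i
                   else if leader F i then vicinity F i else set0).
have Gv i : leader F i -> (diam (G i) <= (8 * 2 ^- scale_of F i)%:E)%E.
  move=> li; apply: diam_le => [|p q].
    by rewrite mulr_ge0// invr_ge0 exprn_ge0.
  have di : 0 < rdiam (F i) by case/andP: li.
  rewrite /G li gt_eqF// => -[_ [p1 p2]] [_ [q1 q2]].
  have -> : (8 : R) * 2 ^- scale_of F i = 4 * (2 * 2 ^- scale_of F i) by rewrite mulrA -natrM.
  exact: (@edist_le_center _ p q (site F i)).
have GF i : (diam (G i) < (16 * delta)%:E)%E.
  have [di|di] := eqVneq (rdiam (F i)) 0.
    apply: (@le_lt_trans _ _ (diam (F i))).
      by apply: sub_diam; rewrite /G di eqxx => x [].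
    by rewrite (lt_trans (Fd i))// lte_fin; lra.
  have [li|/negbTE li] := boolP (leader F i).
    apply: (le_lt_trans (Gv i li)).
    rewrite lte_fin.
    have di0 : 0 < rdiam (F i) by case/andP: li.
    have did : rdiam (F i) < delta by rewrite -lte_fin (rdiamK (Fd i)).
    have did1 : 0 < rdiam (F i) < 1 by rewrite di0 (lt_le_trans did d1).
    have /andP[+ _] := scaleP did1.
    rewrite exprS invfM -/(scale_of F i); move: (2 ^- scale_of F i) did.
    by move: (rdiam _) => d e; lra.
  by rewrite /G li (negbTE di) setI0 diam_set0 lte_fin mulr_gt0.
have cov : A `<=` \bigcup_i G i.
  move=> p Ap; have [i _ Fp] := AF p Ap.
  have [di|di] := eqVneq (rdiam (F i)) 0.
    by exists i => //; rewrite /G di eqxx.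
  have di0 : 0 < rdiam (F i) by rewrite lt_neqAle eq_sym di rdiam_ge0.
  have [j lj cj] := leader_ex di0; exists j => //.
  rewrite /G lj gt_eqF; last by case/andP: lj.
  by split => //; exact: (cell_vicinity d1 Fd di0 cj).
apply: (@le_trans _ _ (\sum_(0 <= i <oo) ((rdiam (G i)) `^ alpha)%:E)%E).
  by apply: ereal_inf_lbound; exists G.
apply: lee_nneseries => [i _ _|i _]; first by rewrite lee_fin powR_ge0.
rewrite lee_fin /hits.
have [di|di] := eqVneq (rdiam (F i)) 0.
  have -> : rdiam (G i) = 0.
    apply/eqP; rewrite eq_le rdiam_ge0 andbT -lee_fin (rdiamK (GF i)) -di (rdiamK (Fd i)).
    by apply: sub_diam; rewrite /G di eqxx => x [].
  by rewrite powR0 ?gt_eqF//; case: ifP; rewrite ?powR_ge0.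
have [li|/negbTE li] := boolP (leader F i); last first.
  by rewrite /= /rdiam /G li (negbTE di) setI0 diam_set0/= powR0 ?gt_eqF.
case: asboolP => /= h.
  apply: ge0_ler_powR; rewrite ?nnegrE ?rdiam_ge0 ?(ltW a0)//.
  by rewrite -lee_fin (rdiamK (GF i)) Gv.
have -> : G i = set0.
  by rewrite -subset0 => p [Ap]; rewrite li (negbTE di) => vp; apply: h; exists p.
by rewrite /rdiam diam_set0 powR0 ?gt_eqF.
Qed.

(** Pigeonhole over the scales: were every scale poor, the whole sum would be at
    most [eta]. *)
Lemma exists_rich_scale (R : realType) (u c : nat -> R) (kappa : nat -> nat)
    (eta : R) :
  (forall i, 0 <= u i) -> 0 <= eta -> (forall k, \sum_(j < k) c j <= 1) ->
  (eta%:E < \sum_(0 <= i <oo) (u i)%:E)%E ->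
  exists k n, eta * c k < \sum_(i < n | kappa i == k) u i.
Proof.
move=> u0 eta0 c1; rewrite ltNge => /negP h; apply: contrapT => /forallNP H.
apply: h; apply: lime_le.
  by apply: is_cvg_nneseries => i _ _; rewrite lee_fin.
apply: nearW => n; rewrite sumEFin lee_fin big_mkord.
pose K := \max_(i < n) kappa i.
rewrite (partition_big (fun i : 'I_n => inord (kappa i) : 'I_K.+1) xpredT)//=.
apply: (@le_trans _ _ (\sum_(k < K.+1) eta * c k)); last first.
  by rewrite -mulr_sumr ler_piMr.
apply: ler_sum => k _.
have /forallNP/(_ n)/negP := H k; rewrite -leNgt; apply: le_trans.
rewrite le_eqVlt; apply/orP; left; apply/eqP; apply: eq_bigl => i.
have iK : (kappa i < K.+1)%N by rewrite ltnS; exact: (leq_bigmax (F := fun i : 'I_n => kappa i) i).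
by rewrite -val_eqE/= inordK.
Qed.

(** * Cells met by pieces of lines *)

(** In units of [2 ^- k], a leader hit by a piece of a line of slope at most 1
    lies within bounded distance of that line. *)
Lemma hits_grid (R : realType) (F : nat -> set (R * R))
    (A : set (R * R)) k i (t beta : R) : 0 <= t <= 1 ->
  (forall p, A p -> p.2 = t * p.1 + beta) -> hits F A i -> scale_of F i = k ->
  `|(cell F i).2%:~R - (t * (cell F i).1.2%:~R + 2 ^+ k * beta)| <= 6 /\
  exists2 p, A p & `|(cell F i).1.2%:~R - 2 ^+ k * p.1| <= 3.
Proof.
move=> t01 Aline /andP[_ /asboolP[p [Ap [p1 p2]]]] sk.
rewrite sk in p1 p2; rewrite /cell sk/=.
have s0 : 0 < (2 : R) ^+ k by exact: exprn_gt0.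
have sc (x y : R) : `|x - y| <= 2 * 2 ^- k -> `|2 ^+ k * x - 2 ^+ k * y| <= 2.
  by move=> h; rewrite -mulrBr normrM gtr0_norm// mulrC -ler_pdivlMr.
have := sc _ _ p1; have := sc _ _ p2.
have := floor_near (2 ^+ k * (site F i).1); have := floor_near (2 ^+ k * (site F i).2).
set a : R := (Num.floor (_ * (site F i).1))%:~R.
set b : R := (Num.floor (_ * (site F i).2))%:~R.
rewrite (Aline _ Ap) mulrDr mulrCA.
set P := 2 ^+ k * p.1; set B := 2 ^+ k * beta.
rewrite !ler_norml => /andP[b1 b2] /andP[a1 a2] /andP[q1 q2] /andP[r1 r2].
split; last by exists p => //; rewrite ler_norml -/P; lra.
have /andP[h1 h2] : - 3 <= t * (P - a) <= 3.
  have : `|t * (P - a)| <= 1 * 3.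
    rewrite normrM ler_pM// ?ler_norml; [|lra].
    by case/andP: t01 => ? ?; lra.
  by rewrite mul1r ler_norml.
lra.
Qed.

(** Two lines whose slopes differ by s stay within distance about [2 ^- k] of
    each other only over an interval of length about [2 ^- k] / s. *)
Lemma card_hits_pair_le (R : realType) (F : nat -> set (R * R))
    (A A' : set (R * R)) k n (J : {set 'I_n}) (t t' beta beta' : R) :
  t != t' -> 0 <= t <= 1 -> 0 <= t' <= 1 ->
  (forall p, A p -> p.2 = t * p.1 + beta) ->
  (forall p, A' p -> p.2 = t' * p.1 + beta') ->
  (forall i, i \in J -> [/\ hits F A i, hits F A' i & scale_of F i = k]) ->
  #|J|%:R <= (24 / `|t - t'| + 1) * 13.
Proof.
move=> tt' t01 t'01 lA lA' hJ.
have s0 : 0 < `|t - t'| by rewrite normr_gt0 subr_eq0.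
apply: (@card_lattice_strip_le _ _ _ (fun i : 'I_n => (cell F i).1.2) (fun i : 'I_n => (cell F i).2)
   (fun a => t * a%:~R + 2 ^+ k * beta - 6)
   (- (2 ^+ k * (beta - beta') / (t - t')) - 12 / `|t - t'|) _ 12).
- by rewrite mulr_ge0// invr_ge0.
- move=> i j /hJ[/andP[li _] _ si] /hJ[/andP[lj _] _ sj] [c1 c2].
  apply/val_inj; apply: (leader_inj li lj).
  move: c1 c2; rewrite /cell /= si sj => -> -> //.
- move=> i /hJ[hi hi' si].
  have [+ _] := hits_grid t01 lA hi si; have [+ _] := hits_grid t'01 lA' hi' si.
  set a : R := (_.1.2)%:~R; set b : R := (_.2)%:~R => h' h.
  have ab : `|a + 2 ^+ k * (beta - beta') / (t - t')| <= 12 / `|t - t'|.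
    rewrite ler_pdivlMr// -normrM mulrDl mulfVK ?subr_eq0//.
    rewrite !ler_norml in h h' *; lra.
  move: ab; rewrite ler_norml (_ : 24 / `|t - t'| = 12 / `|t - t'| + 12 / `|t - t'|); lra.
- move=> i /hJ[hi hi' si]; have [] := hits_grid t01 lA hi si.
  rewrite ler_norml; lra.
Qed.

Lemma card_hits_le (R : realType) (F : nat -> set (R * R))
    (A : set (R * R)) k n (J : {set 'I_n}) (t beta x0 L : R) :
  0 <= L -> 0 <= t <= 1 ->
  (forall p, A p -> p.2 = t * p.1 + beta) ->
  (forall p, A p -> x0 <= p.1 <= x0 + L) ->
  (forall i, i \in J -> hits F A i /\ scale_of F i = k) ->
  #|J|%:R <= (2 ^+ k * L + 7) * 13.
Proof.
move=> L0 t01 lA sA hJ.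
have s0 : 0 < (2 : R) ^+ k by exact: exprn_gt0.
rewrite (_ : 2 ^+ k * L + 7 = (2 ^+ k * L + 6) + 1); last by ring.
apply: (@card_lattice_strip_le _ _ _ (fun i : 'I_n => (cell F i).1.2) (fun i : 'I_n => (cell F i).2)
   (fun a => t * a%:~R + 2 ^+ k * beta - 6)
   (2 ^+ k * x0 - 3) _ 12).
- by rewrite addr_ge0// mulr_ge0// ltW.
- move=> i j /hJ[/andP[li _] si] /hJ[/andP[lj _] sj] [c1 c2].
  apply/val_inj; apply: (leader_inj li lj).
  move: c1 c2; rewrite /cell /= si sj => -> -> //.
- move=> i /hJ[hi si].
  have [_ [p /sA/andP[p1 p2]]] := hits_grid t01 lA hi si.
  have : 2 ^+ k * x0 <= 2 ^+ k * p.1 by rewrite ler_pM2l.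
  have : 2 ^+ k * p.1 <= 2 ^+ k * (x0 + L) by rewrite ler_pM2l.
  rewrite ler_norml mulrDr; lra.
- move=> i /hJ[hi si]; have [] := hits_grid t01 lA hi si.
  rewrite ler_norml; lra.
Qed.

Lemma dyadic_slope_dist (R : realType) (N s s' : R) (l l' : nat) : 0 <= N ->
  l%:R <= N * s < l%:R + 1 -> l'%:R <= N * s' < l'%:R + 1 ->
  (((l - l') + (l' - l)).+1%:R : R) <= N * `|s - s'| + 2.
Proof.
move=> N0 /andP[a1 a2] /andP[b1 b2].
rewrite -[X in X * `|_|]ger0_norm// -normrM mulrBr -natr1.
have [ll|ll] := leqP l l'.
  have -> : ((l - l') + (l' - l) = l' - l)%N by lia.
  rewrite natrB//; apply: (@le_trans _ _ (- (N * s - N * s') + 2)); first lra.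
  by rewrite lerD2r -normrN ler_norm.
have -> : ((l - l') + (l' - l) = l - l')%N by lia.
rewrite natrB ?(ltnW ll)//; apply: (@le_trans _ _ ((N * s - N * s') + 2)); first lra.
by rewrite lerD2r ler_norm.
Qed.

(** The pair bound needed by [incidence_bound]. For slopes in the same or in
    adjacent dyadic intervals nothing is known about their difference, and the
    length [L] of the pieces gives the bound; otherwise the transversality of
    the two lines does. *)
Lemma card_hits_dyadic_le (R : realType) (F : nat -> set (R * R)) (k n : nat)
    (J : {set 'I_n}) (l l' : 'I_(2 ^ k)) (t t' beta beta' x0 L : R)
    (A A' : set (R * R)) : 0 <= L ->
  l%:R <= 2 ^+ k * t < l%:R + 1 -> l'%:R <= 2 ^+ k * t' < l'%:R + 1 ->
  (forall p, A p -> p.2 = t * p.1 + beta) ->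
  (forall p, A' p -> p.2 = t' * p.1 + beta') ->
  (forall p, A p -> x0 <= p.1 <= x0 + L) ->
  (forall i, i \in J -> [/\ hits F A i, hits F A' i & scale_of F i = k]) ->
  #|J|%:R <= (26 * L + 1200) * 2 ^+ k / (((l - l') + (l' - l)).+1%:R).
Proof.
move=> L0 lt lt' lA lA' sA hJ.
set d := ((l - l') + (l' - l))%N.
have N1 : 1 <= (2 : R) ^+ k by rewrite exprn_ege1// ler1n.
have N0 : 0 < (2 : R) ^+ k by exact: exprn_gt0.
have slope01 (j : 'I_(2 ^ k)) (s : R) : j%:R <= 2 ^+ k * s < j%:R + 1 -> 0 <= s <= 1.
  move=> /andP[j1 j2]; apply/andP; split.
    by rewrite -(ler_pM2l N0) mulr0 (le_trans _ j1).
  rewrite -(ler_pM2l N0) mulr1 (le_trans (ltW j2))// natr1 -natrX ler_nat.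
  exact: ltn_ord.
have t01 := slope01 _ _ lt; have t01' := slope01 _ _ lt'.
have dd : (d.+1%:R : R) <= 2 ^+ k * `|t - t'| + 2.
  exact: dyadic_slope_dist (ltW N0) lt lt'.
rewrite ler_pdivlMr ?ltr0n//.
have [d1|d1] := leqP d 1.
  have := card_hits_le L0 t01 lA sA (fun i iJ => let: And3 h1 _ h3 := hJ i iJ in conj h1 h3).
  move=> /le_trans/(_ (_ : _ <= (13 * L + 91) * 2 ^+ k)) h.
  have h1 : #|J|%:R <= (13 * L + 91) * 2 ^+ k by apply: h; nra.
  have d2 : (d.+1%:R : R) <= 2 by rewrite ler_nat.
  have c0 : 0 <= (#|J|%:R : R) by [].
  have e1 : #|J|%:R * d.+1%:R <= (#|J|%:R : R) * 2 by rewrite ler_wpM2l.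
  nra.
have d3 : 3 <= (d.+1%:R : R) by rewrite ler_nat.
have tt' : t != t'.
  by apply/negP => /eqP tE; move: dd; rewrite tE subrr normr0 mulr0 add0r; lra.
have T0 : 0 < `|t - t'| by rewrite normr_gt0 subr_eq0.
have := card_hits_pair_le tt' t01 t01' lA lA' hJ.
have T1 : `|t - t'| <= 1 by rewrite ler_norml; lra.
move=> h1; have {}h1 : #|J|%:R * `|t - t'| <= 325.
  apply: (@le_trans _ _ ((24 / `|t - t'| + 1) * 13 * `|t - t'|)).
    by rewrite ler_wpM2r.
  rewrite -mulrA (mulrC 13) mulrA mulrDl mulfVK ?gt_eqF//; lra.
apply: (@le_trans _ _ (#|J|%:R * (3 * 2 ^+ k * `|t - t'|))).
  by rewrite ler_wpM2l//; lra.
rewrite [leLHS](_ : _ = (#|J|%:R * `|t - t'|) * (3 * 2 ^+ k)); last by ring.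
apply: (@le_trans _ _ (325 * (3 * 2 ^+ k))).
  by rewrite ler_wpM2r// mulr_ge0// ltW.
nra.
Qed.

(** A discrete weak-type estimate for the Kakeya maximal function of the plane:
    few leaders at scale [k] means few slopes that meet many of them. *)
Lemma card_rich_slopes_le (R : realType) (F : nat -> set (R * R)) (k n : nat)
    (T : {set 'I_(2 ^ k)}) (J : {set 'I_n})
    (t beta x0 : 'I_(2 ^ k) -> R) (A : 'I_(2 ^ k) -> set (R * R)) (L D lam : R) :
  0 <= L -> 26 * L + 1200 <= D -> 0 <= lam ->
  (forall i, i \in J -> scale_of F i = k) ->
  (forall l, l \in T -> [/\ l%:R <= 2 ^+ k * t l < l%:R + 1,
     forall p, A l p -> p.2 = t l * p.1 + beta l /\ x0 l <= p.1 <= x0 l + L &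
     lam <= #|[set i in J | hits F (A l) i]|%:R]) ->
  #|T|%:R * lam ^+ 2 <=
    #|J|%:R * (D * 2 ^+ k) * (2 * k.+1%:R).
Proof.
move=> L0 LD lam0 Jk HT.
have D0 : 0 <= D by apply: le_trans LD; rewrite addr_ge0 ?mulr_ge0 ?ler0n.
pose inc l := [set i in J | hits F (A l) i]%SET.
apply: (@incidence_bound R k _ T J inc (D * 2 ^+ k) lam) => //.
- by exact: mulr_ge0.
- by move=> l lT; apply/fintype.subsetP => i; rewrite inE => /andP[].
- move=> l l' lT l'T; have [tl Al _] := HT _ lT; have [tl' Al' _] := HT _ l'T.
  apply: (@le_trans _ _ ((26 * L + 1200) * 2 ^+ k / (((l - l') + (l' - l)).+1%:R))); last first.
    by rewrite ler_wpM2r ?invr_ge0// ler_wpM2r// exprn_ge0.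
  apply: (@card_hits_dyadic_le _ F k n _ l l' (t l) (t l') (beta l) (beta l') (x0 l) L (A l) (A l')) => //.
  + by move=> p /Al[].
  + by move=> p /Al'[].
  + by move=> p /Al[].
  + by move=> i; rewrite !inE => /andP[/andP[iJ ->]] /andP[_ ->]; rewrite Jk.
- by move=> l /HT[].
Qed.

(** * Weights of the scales and the gauge *)

(** Weights of the scales for the pigeonhole. The telescoping form makes their
    sum at most 1 at sight, and they still decay only like [k `^ (- s - 1)]. *)
Definition tele_weight (R : realType) (s : R) (k : nat) : R :=
  k.+1%:R `^ (- s) - k.+2%:R `^ (- s).

Lemma sum_tele_weight_le1 (R : realType) (s : R) (n : nat) :
  \sum_(k < n) tele_weight s k <= 1.
Proof.
have -> : \sum_(k < n) tele_weight s k = 1 - n.+1%:R `^ (- s).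
  elim: n => [|n IH]; first by rewrite big_ord0 powR1 subrr.
  by rewrite big_ord_recr/= IH /tele_weight addrA subrK.
by rewrite lerBlDr lerDl powR_ge0.
Qed.

(** Convexity of [x `^ (- s)], here through [ln (1 - 1 / y) <= - 1 / y]. *)
Lemma tele_weight_ge (R : realType) (s : R) (k : nat) : 0 <= s ->
  s * k.+2%:R `^ (- s - 1) <= tele_weight s k.
Proof.
move=> s0; rewrite /tele_weight.
set x : R := k.+1%:R; set y : R := k.+2%:R.
have x0 : 0 < x by rewrite ltr0n.
have y0 : 0 < y by rewrite ltr0n.
have xy : x = y * (1 + - y^-1).
  by rewrite mulrDr mulr1 mulrN divff ?gt_eqF// /x /y -[k.+2%:R]natr1 addrK.
have q0 : 0 < 1 + - y^-1.
  by rewrite -(pmulr_rgt0 _ y0) -xy.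
have lnq : ln (1 + - y^-1) <= - y^-1 by apply: le_ln1Dx; rewrite -subr_gt0 opprK addrC.
have e1 : 1 + s * y^-1 <= (1 + - y^-1) `^ (- s).
  rewrite -[leRHS]lnK ?posrE ?powR_gt0// ln_powR.
  apply: le_trans (expR_ge1Dx _); rewrite lerD2l mulNr -mulrN ler_wpM2l//.
  by rewrite lerNr.
rewrite {1}xy (powRM _ (ltW y0) (ltW q0)) powRD; last by rewrite (gt_eqF y0) implybT.
rewrite (powR_inv1 (ltW y0)) mulrCA lerBrDl.
by rewrite -(ler_pM2l (powR_gt0 (- s) y0)) mulrDr mulr1 in e1.
Qed.

Lemma powR_sqr (R : realType) (x a : R) : (x `^ a) ^+ 2 = x `^ (2 * a).
Proof. by rewrite mulrC powRrM powR_mulrn ?powR_ge0. Qed.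

(** The number of leaders of scale [k] that a piece must hit if that scale is
    to carry its share [tele_weight _ k / m.+1] of the content, each leader
    contributing at most [(8 * 2 ^- k) `^ alpha]. The exponent
    [theta / 2 - 1] makes the square of the weight comparable to
    [k `^ (- theta)]. *)
Definition hit_threshold (R : realType) (alpha theta : R) (m k : nat) : R :=
  m.+1%:R^-1 * tele_weight (theta / 2 - 1) k / (8 * 2 ^- k) `^ alpha.

(** A lower bound for the gauge at diameters of scale [k], with the logarithm
    of the diameter replaced by a multiple of [k.+2]. *)
Definition gauge_floor (R : realType) (alpha theta C : R) (k : nat) : R :=
  C * (2 ^- k.+1) `^ (2 * alpha) * (k.+2%:R * (ln 2 / 2)) `^ (1 + theta).

Lemma gauge_floor_gt0 (R : realType) (alpha theta C : R) k :
  0 < C -> 0 < gauge_floor alpha theta C k.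
Proof.
move=> C0; rewrite !mulr_gt0// powR_gt0 ?invr_gt0 ?exprn_gt0//.
by rewrite mulr_gt0// divr_gt0// ln_gt0// ltr1n.
Qed.

Lemma gauge_floor_le (R : realType) (alpha theta C d : R) (k : nat) :
  0 < alpha -> 0 < C -> 2 < theta -> d < 4^-1 ->
  2 ^- k.+1 <= d < 2 ^- k ->
  gauge_floor alpha theta C k <=
  C * d `^ (2 * alpha) * ln (1 / d) `^ (1 + theta).
Proof.
move=> a0 C0 th2 d4 /andP[kd dk].
have p0 j : 0 < (2 : R) ^+ j by exact: exprn_gt0.
have d0 : 0 < d by apply: lt_le_trans kd; rewrite invr_gt0.
(* A diameter below 1/4 has scale at least 2, so [k.+2 / 2 <= k]. *)
have k2 : (2 <= k)%N.
  rewrite leqNgt; apply/negP => k1.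
  have : 2 ^- k.+1 < (2 ^- 2 : R) by apply: le_lt_trans kd _; rewrite (_ : 2 ^- 2 = 4^-1)// -natrX.
  by rewrite ltf_pV2 ?posrE// ltr_eXn2l ?ltr1n// ltnS leqNgt k1.
have l2 : 0 < ln (2 : R) by rewrite ln_gt0// ltr1n.
rewrite /gauge_floor ler_pM ?mulr_ge0 ?powR_ge0 ?(ltW C0)//.
  rewrite ler_pM2l//; apply: ge0_ler_powR; rewrite ?nnegrE ?mulr_ge0 ?invr_ge0 ?(ltW a0) ?(ltW d0) ?(ltW (p0 _))//.
have lnd : k.+2%:R * (ln 2 / 2) <= ln (1 / d).
  apply: (@le_trans _ _ (ln (2 ^+ k))).
    rewrite lnXn// -[leRHS]mulr_natl mulrA mulrAC ler_wpM2r// ?(ltW l2)//.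
    rewrite ler_pdivrMr// -natrM ler_nat; lia.
  rewrite ler_ln ?posrE ?divr_gt0// div1r.
  by rewrite -[leLHS]invrK lef_pV2 ?posrE ?invr_gt0// ltW.
have z0 : 0 <= k.+2%:R * (ln 2 / 2) :> R by rewrite mulr_ge0// divr_ge0// ltW.
by apply: ge0_ler_powR; rewrite ?nnegrE ?(le_trans z0 lnd)//; lra.
Qed.

Lemma hit_threshold_gt0 (R : realType) (alpha theta : R) m k : 2 < theta ->
  0 < hit_threshold alpha theta m k.
Proof.
move=> th2; rewrite divr_gt0 ?powR_gt0 ?mulr_gt0 ?invr_gt0 ?exprn_gt0//.
have s0 : 0 < theta / 2 - 1 by lra.
by apply: lt_le_trans (tele_weight_ge k (ltW s0)); rewrite mulr_gt0 ?powR_gt0.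
Qed.

Definition slope_const (R : realType) (alpha theta C D : R) (m : nat) : R :=
  2 * D * m.+1%:R ^+ 2 * 16 `^ (2 * alpha) /
  ((theta / 2 - 1) ^+ 2 * C * (ln 2 / 2) `^ (1 + theta)).

Lemma slope_const_gt0 (R : realType) (alpha theta C D : R) m :
  0 < C -> 0 < D -> 2 < theta -> 0 < slope_const alpha theta C D m.
Proof.
move=> C0 D0 th2.
have l2 : 0 < ln (2 : R) by rewrite ln_gt0// ltr1n.
by rewrite divr_gt0 ?mulr_gt0 ?powR_gt0 ?exprn_gt0 ?divr_gt0//; lra.
Qed.

(** Where the exponent of the logarithm is spent: the harmonic sum costs one
    factor [k.+2], and the square of the weight costs [k `^ theta]. *)
Lemma slope_const_bound (R : realType) (alpha theta C D : R) m k :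
  0 < C -> 0 < D -> 2 < theta ->
  D * (2 * k.+1%:R) <= slope_const alpha theta C D m *
    gauge_floor alpha theta C k * hit_threshold alpha theta m k ^+ 2.
Proof.
move=> C0 D0 th2.
have l2 : 0 < ln (2 : R) by rewrite ln_gt0// ltr1n.
rewrite /slope_const /gauge_floor /hit_threshold.
set s := theta / 2 - 1.
have : 0 < ln 2 / 2 :> R by rewrite divr_gt0.
move: (ln 2 / 2) => h2 h20.
have : 0 < m.+1%:R :> R by [].
move: (m.+1%:R : R) => M M0.
have s0 : 0 < s by rewrite /s; lra.
have p0 j : 0 < (2 : R) ^+ j by exact: exprn_gt0.
have -> : (8 : R) * 2 ^- k = 16 * 2 ^- k.+1.
  by rewrite exprS invfM mulrA; congr (_ * _); lra.
rewrite !powRM ?invr_ge0 ?(ltW (p0 _)) ?(ltW h20)//.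
rewrite !expr_div_n exprMn [in (_ `^ alpha * _) ^+ 2]exprMn !powR_sqr.
have W0 := tele_weight_ge k (ltW s0).
set W := tele_weight s k in W0 *.
have W2 : s ^+ 2 * k.+2%:R `^ (- theta) <= W ^+ 2.
  have -> : - theta = 2 * (- s - 1) by rewrite /s; lra.
  rewrite -powR_sqr -exprMn ler_sqr ?nnegrE ?(le_trans _ W0)//;
  by rewrite mulr_ge0 ?powR_ge0 ?(ltW s0).
have K0 : 0 < (k.+2%:R : R) `^ (- theta) by rewrite powR_gt0.
have Kth : (k.+2%:R : R) `^ (1 + theta) * k.+2%:R `^ (- theta) = k.+2%:R.
  rewrite -powRD; last by rewrite (@pnatr_eq0 R) implybT.
  by rewrite addrK powRr1.
set P := 16 `^ (2 * alpha); set Q := (2 ^- k.+1) `^ (2 * alpha).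
set X := h2 `^ (1 + theta); set Y := k.+2%:R `^ (1 + theta).
have P0 : 0 < P by rewrite powR_gt0.
have Q0 : 0 < Q by rewrite powR_gt0 ?invr_gt0.
have X0 : 0 < X by rewrite powR_gt0.
have Y0 : 0 < Y by rewrite powR_gt0.
rewrite [leRHS](_ : _ = D * 2 * (Y * (W ^+ 2 / s ^+ 2))); last first.
  by field; rewrite !gt_eqF.
rewrite mulrA ler_pM2l ?mulr_gt0//.
apply: (@le_trans _ _ (k.+2%:R)); first by rewrite ler_nat.
rewrite -Kth ler_pM2l// ler_pdivlMr ?exprn_gt0// mulrC.
exact: W2.
Qed.

(** * Nonnegative sums sorted by scale *)

Lemma large_terms_bounded (R : realType) (f : nat -> R) (w M : R) :
  (forall i, 0 <= f i) -> (forall n, \sum_(0 <= i < n) f i <= M) -> 0 < w ->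
  exists n, forall i, w <= f i -> (i < n)%N.
Proof.
move=> f0 fM w0; apply: contrapT => /forallNP H.
have big p : exists n, p%:R * w <= \sum_(0 <= i < n) f i.
  elim: p => [|p [n pn]]; first by exists 0%N; rewrite mul0r big_geq.
  have /existsNP[i /not_implyP[wi /negP]] := H n.
  rewrite -leqNgt => ni; exists i.+1.
  rewrite big_nat_recr//= -natr1 mulrDl mul1r lerD//.
  apply: (le_trans pn); rewrite (big_cat_nat (leq0n n) ni)/= lerDl.
  by apply: sumr_ge0.
have [n] := big (Num.truncn (M / w)).+1.
apply/negP; rewrite -ltNge (le_lt_trans (fM n))// -ltr_pdivrMr//.
exact: truncnS_gt.
Qed.

Lemma sum_ord_le_support (R : realDomainType) (f : nat -> R) (P : pred nat)
    (n N : nat) : (forall i, 0 <= f i) -> (forall i, P i -> (i < N)%N) ->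
  \sum_(i < n | P i) f i <= \sum_(i < N | P i) f i.
Proof.
move=> f0 PN.
rewrite -(big_mkord P f) -(big_mkord P f).
have [nN|/ltnW Nn] := leqP n N.
  by rewrite (big_cat_nat (leq0n n) nN)/= lerDl sumr_ge0.
rewrite (big_cat_nat (leq0n N) Nn)/= [X in _ + X]big_nat_cond.
rewrite [X in _ + X]big_pred0 ?addr0// => i.
by apply/negP => /andP[/andP[Ni _] /PN]; rewrite ltnNge Ni.
Qed.

(** Each index belongs to one scale only. *)
Lemma sum_scales_le (R : realDomainType) (f : nat -> R) (kappa nn : nat -> nat)
    (P : pred nat) (M : R) (K : nat) :
  (forall i, 0 <= f i) -> (forall n, \sum_(0 <= i < n) f i <= M) ->
  \sum_(k < K) \sum_(i < nn k | P i && (kappa i == k)) f i <= M.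
Proof.
move=> f0 fM.
pose N := \max_(k < K) nn k.
apply: le_trans (fM N).
apply: (@le_trans _ _ (\sum_(k < K) \sum_(i < N | kappa i == k) f i)).
  apply: ler_sum => k _.
  have kN : (nn k <= N)%N by exact: (leq_bigmax (F := fun k : 'I_K => nn k) k).
  rewrite -(big_mkord (fun i => P i && (kappa i == k)) f).
  rewrite -(big_mkord (fun i => kappa i == k) f) (big_cat_nat (leq0n _) kN)/=.
  apply: ler_wpDr; first exact: sumr_ge0.
  rewrite big_mkcond [leRHS]big_mkcond; apply: ler_sum => i _.
  by case: (P i) => //=; case: ifP.
rewrite (exchange_big_dep xpredT)//= big_mkord ler_sum// => i _.
have [iK|Ki] := ltnP (kappa i) K; last first.
  rewrite big_pred0// => k; apply/negP => /eqP kE.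
  by move: (ltn_ord k); rewrite -kE ltnNge Ki.
rewrite (eq_bigl (pred1 (Ordinal iK))); first by rewrite big_pred1_eq.
move=> k; rewrite /= -val_eqE/=; exact: eq_sym.
Qed.

(** * Unions of dyadic intervals of slopes *)

Definition dyadic_union (R : realType) (k : nat) (T : {set 'I_(2 ^ k)}) :
    set R :=
  \big[setU/set0]_(l in T) [set` `[l%:R * 2 ^- k, (l%:R + 1) * 2 ^- k[].

Lemma dyadic_unionP (R : realType) k (T : {set 'I_(2 ^ k)}) (l : 'I_(2 ^ k))
    (t : R) : l \in T -> l%:R <= 2 ^+ k * t < l%:R + 1 -> dyadic_union T t.
Proof.
move=> lT /andP[l1 l2]; rewrite /dyadic_union -bigcup_seq_cond/=; exists l.
  by rewrite /= mem_index_enum lT.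
have p0 : 0 < (2 : R) ^+ k by exact: exprn_gt0.
by rewrite /= in_itv/= ler_pdivrMr// ltr_pdivlMr// mulrC l1.
Qed.

Lemma measurable_dyadic_union (R : realType) k (T : {set 'I_(2 ^ k)}) :
  measurable (dyadic_union T : set R).
Proof. by apply: bigsetU_measurable => l _; exact: measurable_itv. Qed.

Lemma lebesgue_dyadic_union_le (R : realType) k (T : {set 'I_(2 ^ k)}) :
  (lebesgue_measure (dyadic_union T : set R) <= (#|T|%:R * 2 ^- k)%:E)%E.
Proof.
have -> : (#|T|%:R * 2 ^- k)%:E = (\sum_(l in T) (2 ^- k : R)%:E)%E.
  by rewrite sumEFin sumr_const mulr_natl.
suff [] : measurable (dyadic_union T : set R) /\
  (lebesgue_measure (dyadic_union T : set R) <= \sum_(l in T) (2 ^- k : R)%:E)%E by [].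
rewrite /dyadic_union; apply: (big_ind2 (fun (X : set R) y =>
    measurable X /\ (lebesgue_measure X <= y)%E)).
- by rewrite measure0.
- move=> X x Y y [mX Xx] [mY Yy]; split; first exact: measurableU.
  apply: (@le_trans _ _ (lebesgue_measure X + lebesgue_measure Y)%E).
    exact: measureU2.
  exact: leeD.
- move=> l _; split; first exact: measurable_itv.
  have p0 : 0 < (2 : R) ^- k by rewrite invr_gt0 exprn_gt0.
  rewrite lebesgue_measure_itv/= lte_fin ltr_pM2r// ltrDl ltr01.
  by rewrite -EFinB -mulrBl addrAC subrr add0r mul1r.
Qed.

(** * Rich slopes form a null set *)

Lemma le_hausdorff_content (R : realType) (g : R -> R) (d d' : R)
    (A : set (R * R)) : d <= d' ->
  (hausdorff_content g d' A <= hausdorff_content g d A)%E.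
Proof.
move=> dd'; apply: le_ereal_inf => _ [F [AF Fd] <-]; exists F => //; split => // i.
by rewrite (lt_le_trans (Fd i))// lee_fin.
Qed.

(** Slopes of lines with a quantitative piece of [E]; for a fixed [m] the length
    of the piece, its content and the radius at which the content is taken are
    all controlled by [m]. *)
Definition rich_slope (R : realType) (alpha : R) (E : set (R * R)) (m : nat)
    (t : R) : Prop :=
  exists beta x0 : R, exists A : set (R * R),
    [/\ A `<=` E,
        forall p, A p -> p.2 = t * p.1 + beta /\ x0 <= p.1 <= x0 + m%:R &
        ((m.+1%:R^-1)%:E <
          hausdorff_content (fun x : R => x `^ alpha)%R m.+1%:R^-1 A)%E].

Lemma exists_hit_threshold (R : realType) (alpha theta delta : R)
    (F : nat -> set (R * R)) (A : set (R * R)) (m : nat) :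
  0 < alpha -> delta <= 1 -> 16 * delta <= m.+1%:R^-1 ->
  (forall i, (diam (F i) < delta%:E)%E) -> A `<=` \bigcup_i F i ->
  ((m.+1%:R^-1)%:E <
    hausdorff_content (fun x : R => x `^ alpha)%R m.+1%:R^-1 A)%E ->
  exists k n, hit_threshold alpha theta m k <=
    \sum_(i < n | leader F i && (scale_of F i == k)) (hits F A i)%:R.
Proof.
move=> a0 d1 dm Fd AF Ac.
have := lt_le_trans (lt_le_trans Ac (le_hausdorff_content _ _ dm))
  (content_le_hits a0 d1 Fd AF).
move=> /(@exists_rich_scale _ _ (tele_weight (theta / 2 - 1)) (scale_of F)) [].
- by move=> i; case: ifP => // _; rewrite powR_ge0.
- by rewrite invr_ge0.
- exact: sum_tele_weight_le1.
move=> k [n kn]; exists k, n.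
rewrite /hit_threshold ler_pdivrMr ?powR_gt0 ?mulr_gt0 ?invr_gt0 ?exprn_gt0//.
apply: (le_trans (ltW kn)).
rewrite mulr_suml [leRHS]big_mkcond [leLHS]big_mkcond.
apply: ler_sum => i _.
have [/eqP ik|] := boolP (scale_of F i == k); last by rewrite andbF.
have [h|_] := boolP (hits F A i).
  by have /andP[li _] := h; rewrite li ik mul1r.
by case: ifP; rewrite ?mul0r.
Qed.

(** Cover [E] by sets with small sum of [h] over the diameters. Every rich slope
    has a scale [k] at which its piece hits many leaders, hence lies in one of
    the dyadic intervals [T k]; by [card_rich_slopes_le] and
    [slope_const_bound] the total length of these intervals is at most
    [K] times the sum of [h] over the leaders of scale [k]. Summing over [k]
    gives at most [K] times the sum over the cover. *)
Lemma null_rich_slopes (R : realType) (alpha theta C r : R)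
    (E : set (R * R)) (h : R -> R) (m : nat) (eps : R) :
  0 < alpha -> 0 < C -> 2 < theta -> (forall x, 0 <= x -> 0 <= h x) ->
  0 < r ->
  (forall x, 0 < x < r ->
     C * x `^ (2 * alpha) * ln (1 / x) `^ (1 + theta) <= h x) ->
  (forall delta, 0 < delta -> (hausdorff_content h delta E <= 0)%E) ->
  0 < eps ->
  exists B : set R, [/\ measurable B, (lebesgue_measure B <= eps%:E)%E &
    forall t, 0 <= t < 1 -> rich_slope alpha E m t -> B t].
Proof.
move=> a0 C0 th2 h0 r0 hlow hE eps0.
have [D [D0 mD]] : exists D : R, 0 < D /\ 26 * m%:R + 1200 <= D.
  exists (26 * m%:R + 1200); split; last exact: lexx.
  by apply: ltr_wpDl; rewrite ?mulr_ge0 ?ltr0n.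
pose K := slope_const alpha theta C D m.
have K0 : 0 < K by exact: slope_const_gt0.
have [delta [d0 dr d8 dm]] : exists delta : R,
    [/\ 0 < delta, delta <= r, delta <= 8^-1 & 16 * delta <= m.+1%:R^-1].
  have m0 : 0 < (m.+1%:R^-1 : R) by rewrite invr_gt0.
  exists (Num.min r (Num.min 8^-1 (m.+1%:R^-1 / 16))).
  split; rewrite ?lt_min ?ge_min ?lexx ?orbT//.
    by rewrite r0 invr_gt0 ltr0n divr_gt0.
  rewrite mulrC -ler_pdivlMr//.
  by rewrite !ge_min lexx !orbT.
have d1 : delta <= 1 by lra.
have [F [EF Fd] hF] : exists2 F : nat -> set (R * R),
    E `<=` \bigcup_i F i /\ (forall i, (diam (F i) < delta%:E)%E) &
    (\sum_(0 <= i <oo) (h (fine (diam (F i))))%:E < (eps / K)%:E)%E.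
  have : (hausdorff_content h delta E < (eps / K)%:E)%E.
    by apply: le_lt_trans (hE _ d0) _; rewrite lte_fin divr_gt0.
  by move=> /ereal_inf_lt[_ [F HF <-] lt]; exists F.
pose f i := h (rdiam (F i)).
have f0 i : 0 <= f i by apply: h0; exact: rdiam_ge0.
have fsum n : \sum_(0 <= i < n) f i <= eps / K.
  rewrite -lee_fin -sumEFin; apply: le_trans (ltW hF).
  by apply: nneseries_lim_ge => i _ _; rewrite lee_fin; exact: f0.
have floorf i : leader F i -> gauge_floor alpha theta C (scale_of F i) <= f i.
  move=> /andP[di _].
  have did : rdiam (F i) < delta by rewrite -lte_fin (rdiamK (Fd i)).
  have di1 : 0 < rdiam (F i) < 1 by rewrite di (lt_le_trans did).
  apply: (le_trans (gauge_floor_le a0 C0 th2 _ (scaleP di1))).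
    apply: (lt_trans (lt_le_trans did d8)).
    by rewrite ltf_pV2 ?posrE// ltr_nat.
  by apply: hlow; rewrite di (lt_le_trans did).
(* Each scale has finitely many leaders, because their values of [h] are
   bounded below and have a finite sum. *)
have [nn hnn] : exists nn : nat -> nat, forall k i,
    leader F i && (scale_of F i == k) -> (i < nn k)%N.
  have /choice[nn hnn] : forall k, exists n, forall i,
      gauge_floor alpha theta C k <= f i -> (i < n)%N.
    by move=> k; apply: (large_terms_bounded f0 fsum); exact: gauge_floor_gt0.
  by exists nn => k i /andP[li /eqP ik]; apply: hnn; rewrite -ik floorf.
pose J k := [set i : 'I_(nn k) | leader F i && (scale_of F i == k)]%SET.
(* A witness [w] packs a slope, an intercept, the left end of the projection to
   the first axis, and a piece of [E]. *)
pose P k (l : 'I_(2 ^ k)) (w : R * R * R * set (R * R)) :=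
  [/\ l%:R <= 2 ^+ k * w.1.1.1 < l%:R + 1,
    forall p, w.2 p -> p.2 = w.1.1.1 * p.1 + w.1.1.2 /\
      w.1.2 <= p.1 <= w.1.2 + m%:R &
    hit_threshold alpha theta m k <= #|[set i in J k | hits F w.2 i]%SET|%:R].
pose T k := [set l : 'I_(2 ^ k) | `[< exists w, P k l w >]]%SET.
have cardT k : #|T k|%:R * 2 ^- k <= K * (#|J k|%:R * gauge_floor alpha theta C k).
  have /choice[w hw] : forall l : 'I_(2 ^ k), exists w, l \in T k -> P k l w.
    move=> l; have [|nT] := boolP (l \in T k).
      by rewrite inE => /asboolP[w hw]; exists w.
    by exists (0, 0, 0, set0).
  have lam0 := hit_threshold_gt0 alpha m k th2.
  have Jk i : i \in J k -> scale_of F i = k by rewrite inE => /andP[_ /eqP].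
  have := card_rich_slopes_le (t := fun l => (w l).1.1.1) (beta := fun l => (w l).1.1.2)
    (x0 := fun l => (w l).1.2) (A := fun l => (w l).2)
    (ler0n R m) mD (ltW lam0) Jk hw.
  rewrite [leRHS](_ : _ = #|J k|%:R * 2 ^+ k * (D * (2 * k.+1%:R))); last by ring.
  move=> TJ.
  have p0 : 0 < (2 : R) ^+ k by exact: exprn_gt0.
  have := le_trans TJ (ler_wpM2l (mulr_ge0 (ler0n R #|J k|) (ltW p0))
    (slope_const_bound alpha m k C0 D0 th2)).
  rewrite -/K => {}TJ.
  have TK : #|T k|%:R <= #|J k|%:R * 2 ^+ k * (K * gauge_floor alpha theta C k).
    rewrite -(ler_pM2r (exprn_gt0 2 lam0)); apply: (le_trans TJ).
    by rewrite le_eqVlt; apply/orP; left; apply/eqP; ring.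
  rewrite ler_pdivrMr//; apply: (le_trans TK); rewrite le_eqVlt; apply/orP; left.
  apply/eqP; ring.
exists (\bigcup_k dyadic_union (T k)); split.
- by apply: bigcupT_measurable => k; exact: measurable_dyadic_union.
- apply: (@le_trans _ _ (\sum_(0 <= k <oo) (#|T k|%:R * 2 ^- k : R)%:E)%E).
    apply: (@le_trans _ _ (\sum_(0 <= k <oo) lebesgue_measure (dyadic_union (T k) : set R))%E).
      apply: measure_sigma_subadditive => //.
        by move=> k; exact: measurable_dyadic_union.
      by apply: bigcupT_measurable => k; exact: measurable_dyadic_union.
    by apply: lee_nneseries => // k _; exact: lebesgue_dyadic_union_le.
  apply: lime_le.
    apply: is_cvg_nneseries => k _ _.
    by rewrite lee_fin mulr_ge0// invr_ge0 exprn_ge0.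
  apply: nearW => N; rewrite sumEFin lee_fin big_mkord.
  apply: (@le_trans _ _ (K * \sum_(k < N) \sum_(i < nn k | leader F i && (scale_of F i == k)) f i)).
    rewrite mulr_sumr; apply: ler_sum => k _.
    apply: (le_trans (cardT k)); rewrite ler_pM2l//.
    rewrite mulr_natl -sumr_const.
    rewrite (eq_bigl (fun i : 'I_(nn k) => leader F i && (scale_of F i == k))); last first.
      by move=> i; rewrite inE.
    by apply: ler_sum => i /andP[li /eqP ik]; have := floorf _ li; rewrite ik.
  rewrite mulrC -ler_pdivlMr//.
  exact: sum_scales_le.
- move=> t /andP[t0 t1] [beta [x0 [A [AE lA Ac]]]].
  have [k [n kn]] := exists_hit_threshold theta a0 d1 dm Fd (subset_trans AE EF) Ac.
  have p0 : 0 < (2 : R) ^+ k by exact: exprn_gt0.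
  have lt : 0 <= 2 ^+ k * t by rewrite mulr_ge0// ltW.
  have /andP[l1 l2] := truncn_itv lt.
  have lk : (Num.truncn (2 ^+ k * t) < 2 ^ k)%N.
    by rewrite truncn_lt_nat// natrX -[ltRHS]mulr1 ltr_pM2l.
  exists k => //; apply: (@dyadic_unionP _ _ _ (Ordinal lk)); last first.
    by rewrite /= l1 natr1 l2.
  rewrite inE; apply/asboolP; exists (t, beta, x0, A); split => //=.
    by rewrite l1 natr1 l2.
  apply: (le_trans kn).
  have := @sum_ord_le_support R (fun i => (hits F A i)%:R)
    (fun i => leader F i && (scale_of F i == k)) n (nn k)
    (fun i => ler0n R (hits F A i)) (hnn k).
  move=> /le_trans; apply.
  rewrite le_eqVlt; apply/orP; left; apply/eqP.
  rewrite -sum1_card natr_sum big_mkcond [RHS]big_mkcond.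
  apply: eq_bigr => i _; rewrite !inE.
  by case: (_ && _) => //; case: hits.
Qed.

(** * Conclusion *)

(** The direction used is (1, t) normalized; its first coordinate is at most 1,
    so a segment of length [L] projects to an interval of length at most [L]. *)
Lemma rich_slope_exists (R : realType) (alpha : R) (E : set (R * R)) (t : R) :
  Fplus_set alpha E -> exists m, rich_slope alpha E m t.
Proof.
move=> hE.
pose c := (Num.sqrt (1 + t ^+ 2))^-1.
have q1 : 1 <= 1 + t ^+ 2 by rewrite lerDl sqr_ge0.
have s0 : 0 < Num.sqrt (1 + t ^+ 2) by rewrite sqrtr_gt0; lra.
have c0 : 0 < c by rewrite invr_gt0.
have cE : c ^+ 2 * (1 + t ^+ 2) = 1.
  rewrite exprVn sqr_sqrtr; last by lra.
  by rewrite mulVf// gt_eqF//; lra.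
have c1 : c <= 1.
  by rewrite -(ler_sqr (x := c)) ?nnegrE ?(ltW c0)// expr1n; nra.
have [|p [L [L0 HL]]] := hE (c, t * c).
  rewrite /unit_circle/= /edist/= !subr0.
  rewrite (_ : c ^+ 2 + (t * c) ^+ 2 = 1) ?sqrtr1// -cE; ring.
have [_ [d d0 <-] cd] := ereal_sup_gt HL.
have [r [r0 rc]] : exists r : R, 0 < r /\ (r%:E < hausdorff_content
    (fun x : R => x `^ alpha)%R d (segment p (c, (t * c)%R) L `&` E))%E.
  case: (hausdorff_content _ _ _) cd => [x| |//]; last by exists 1; rewrite ltey.
  by rewrite lte_fin => x0; exists (x / 2); rewrite lte_fin; lra.
pose m := Num.truncn (L + r^-1 + d^-1).
have hm : L + r^-1 + d^-1 < m.+1%:R by exact: truncnS_gt.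
have ri : 0 < r^-1 by rewrite invr_gt0.
have di : 0 < d^-1 by rewrite invr_gt0.
have mle (x : R) : 0 < x -> x^-1 <= m.+1%:R -> m.+2%:R^-1 <= x.
  move=> x0 xm; rewrite invf_ple ?posrE//; apply: (le_trans xm).
  by rewrite ler_nat.
exists m.+1, (p.2 - t * p.1), p.1, (segment p (c, t * c) L `&` E); split.
- by move=> x [].
- move=> q [[u /= uL <-] _]; split => /=.
    change (p.2 + u * (t * c) = t * (p.1 + u * c) + (p.2 - t * p.1)); ring.
  change (p.1 <= p.1 + u * c <= p.1 + m.+1%:R).
  move: uL; rewrite in_itv/= => /andP[u0 uL].
  have uc0 : 0 <= u * c by rewrite mulr_ge0// ltW.
  have ucu : u * c <= u by rewrite ler_piMr.
  lra.
- apply: (@le_lt_trans _ _ r%:E); first by rewrite lee_fin mle//; lra.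
  apply: (lt_le_trans rc); apply: le_hausdorff_content.
  by apply: mle => //; lra.
Qed.

Theorem corollary3p2 (R : realType) (alpha : R) (halpha0 : 0 < alpha)
    (halpha1 : alpha <= 1) (E : set (R * R)) (hE : Fplus_set alpha E)
    (h : R -> R) (hh : dimension_function h) (C theta : R) (hC : 0 < C)
    (htheta : 2 < theta)
    (hlow : \forall x \near 0^'+,
        C * x `^ (2 * alpha) * ln (1 / x) `^ (1 + theta) <= h x) :
  (0 < hausdorff_measure h E)%E.
Proof.
rewrite ltNge; apply/negP => H0.
have Hcontent delta : 0 < delta -> (hausdorff_content h delta E <= 0)%E.
  by move=> d0; apply: le_trans H0; apply: ereal_sup_ubound; exists delta.
have [h0 _ _ _] := hh.
have [r r0 hr] : exists2 r : R, 0 < r & forall x, 0 < x < r ->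
    C * x `^ (2 * alpha) * ln (1 / x) `^ (1 + theta) <= h x.
  move: hlow => [r /= r0 Hr]; exists r => // x /andP[x0 xr].
  by apply: Hr => //=; rewrite sub0r normrN gtr0_norm.
have eps0 (m : nat) : 0 < 2^-1 / (2 ^ m.+1)%:R :> R.
  by rewrite divr_gt0 ?ltr0n ?expn_gt0// invr_gt0.
have /choice[B HB] := fun m => null_rich_slopes m halpha0 hC htheta h0 r0 hr Hcontent (eps0 m).
have : (lebesgue_measure (`[0%R, 1%R[%classic : set R) <= (2^-1)%:E)%E.
  apply: (@le_trans _ _ (\sum_(0 <= m <oo) lebesgue_measure (B m))%E).
    apply: measure_sigma_subadditive.
    - by move=> m; have [] := HB m.
    - exact: measurable_itv.
    - move=> t; rewrite /= in_itv/= => t01.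
      have [m mt] := rich_slope_exists t hE.
      by exists m => //; have [_ _] := HB m; apply.
  have half0 : 0 <= 2^-1 :> R by rewrite invr_ge0.
  have := @epsilon_trick R (fun=> 0%E) 2^-1 xpredT (fun=> lexx _) half0.
  have -> : (\sum_(0 <= i <oo) (0 : \bar R) = 0)%E by rewrite eseries0.
  rewrite add0e; apply: le_trans; apply: lee_nneseries => // m _.
  by have [_ Bm _] := HB m; rewrite /= add0e.
rewrite lebesgue_measure_itv/= lte_fin ltr01 oppr0 adde0 lee_fin.
by rewrite leNgt invf_lt1 ?ltr1n.
Qed.
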